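(* Let $\mathcal{L}$ be a task list in which every task drives one degree of freedom and reads one, that is $f_j=e_{\sigma_j}$ and $g_j=e_{\tau_j}$ with $\sigma_j,\tau_j\in\{1,\dots,n\}$, and let $\mathcal{D}_{\mathcal{L}}$ be the digraph on $\{1,\dots,n\}$ with an arc $\sigma_j\to\tau_j$ for each task (repeated tasks contributing the same arc). Then $$\delta_{\mathcal{L}}=\#\bigl\{\{u,v\}:u\ne v,\ \text{both }u\to v\text{ and }v\to u\text{ lie in }\mathcal{D}_{\mathcal{L}}\bigr\},$$ the number of two-cycles (digons) of $\mathcal{D}_{\mathcal{L}}$. A self-loop $u\to u$ contributes nothing, and $\delta_{\mathcal{L}}=0$ exactly when there is no pair $u\neq v$ with both arcs $u\to v$ and $v\to u$ present.
   Context: Task list: a finite family $\mathcal{L}=\{(f_j,g_j,y^{*}_j)\}_{j=1}^{J}$ with $f_j,g_j\in\mathbb{R}^{n}$, $y_j^{*}\in\mathbb{R}$. $\mathsf{M}_j=g_jf_j^{T}\in\mathbb{R}^{n\times n}$, $\operatorname{sym}A=\tfrac12(A+A^{T})$, $\mathcal{M}=\operatorname{span}\{\mathsf{M}_j\}$, $\mathcal{M}^{s}=\operatorname{span}\{\operatorname{sym}\mathsf{M}_j\}$, and the deficit of the list is $\delta_{\mathcal{L}}=\dim\mathcal{M}-\dim\mathcal{M}^{s}$. $e_u$ are the standard basis vectors of $\mathbb{R}^n$. *)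

(* Defs.v *)
From mathcomp Require Import all_boot all_order all_algebra.
From mathcomp Require Import reals.

Set Implicit Arguments.
Unset Strict Implicit.
Unset Printing Implicit Defensive.

Import GRing.Theory.

Local Open Scope ring_scope.

(* A task (f, g, y* ): it drives along f, reads along g, and aims at y*. *)
Record task (R : realType) (n : nat) := Task {
  drive : 'cV[R]_n;
  read : 'cV[R]_n;
  target : R
}.

Definition std_basis (R : realType) (n : nat) (u : 'I_n) : 'cV[R]_n :=
  delta_mx u ord0.

Definition task_mx (R : realType) (n : nat) (t : task R n) : 'M[R]_n :=
  read t *m (drive t)^T.

Definition sym (R : realType) (n : nat) (A : 'M[R]_n) : 'M[R]_n :=
  2%:R^-1 *: (A + A^T).

(* Task lists are indexed by an arbitrary finite type, so that sublists are
   again task lists. *)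
Definition task_span (R : realType) (n : nat) (I : finType)
    (L : I -> task R n) : {vspace 'M[R]_n} :=
  <<[seq task_mx (L j) | j : I]>>%VS.

Definition sym_task_span (R : realType) (n : nat) (I : finType)
    (L : I -> task R n) : {vspace 'M[R]_n} :=
  <<[seq sym (task_mx (L j)) | j : I]>>%VS.

(* The difference is taken in int: no truncated subtraction. *)
Definition deficit (R : realType) (n : nat) (I : finType)
    (L : I -> task R n) : int :=
  (\dim (task_span L))%:Z - (\dim (sym_task_span L))%:Z.

Definition sublist (R : realType) (n : nat) (I : finType)
    (L : I -> task R n) (S : {set I}) : {j : I | j \in S} -> task R n :=
  fun j => L (val j).
Arguments sublist {R n I} L S j.

Definition task_digraph (n : nat) (I : finType) (sigma tau : I -> 'I_n) :
    rel 'I_n :=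
  fun u v => [exists j, (sigma j == u) && (tau j == v)].

Definition digons (n : nat) (D : rel 'I_n) : {set {set 'I_n}} :=
  [set [set u; v] | u in 'I_n, v in 'I_n & [&& u != v, D u v & D v u]].

(* Main.v *)
Require Import Defs.
From mathcomp Require Import all_boot all_order all_algebra.
From mathcomp Require Import reals zify.

Set Implicit Arguments.
Unset Strict Implicit.
Unset Printing Implicit Defensive.

Import GRing.Theory Num.Theory.

Local Open Scope ring_scope.

(** Since [task_mx] is the matrix unit [delta_mx (tau j) (sigma j)], the dimension
    of its span counts the arcs, and symmetrizing identifies exactly the opposite
    arcs, so that the dimension of the symmetrized span counts the underlying
    unordered pairs (loops included).  An unordered pair carries two arcs when it
    is a digon and one arc otherwise, so the two counts differ by the number of
    digons. *)

(* The entry [(k.2, k.1)] is the coordinate dual to [W k]. *)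
Lemma dim_span_dual_entries (F : fieldType) (n : nat) (I : finType)
    (key : I -> 'I_n * 'I_n) (W : 'I_n * 'I_n -> 'M[F]_n) :
  (forall i j, (W (key i) (key j).2 (key j).1 != 0) = (key i == key j)) ->
  \dim <<[seq W (key i) | i : I]>>%VS = #|key @: I|.
Proof.
move=> dualW; set s := enum (mem (key @: I)).
(* Repeated keys give repeated generators; listing each key once leaves the span unchanged and lets
   the family be free. *)
have memW : [seq W (key i) | i : I] =i [seq W k | k <- s].
  move=> M; apply/mapP/mapP => [[i _ ->]|[k]].
    by exists (key i); rewrite // mem_enum imset_f.
  by rewrite mem_enum => /imsetP[i _ ->] ->; exists i; rewrite ?mem_enum.
rewrite (eq_span memW) cardE -/s -(size_map W s).
apply/eqP; change (free (in_tuple (map W s))); apply/freeP => a.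
have in_s (i : 'I_(size (map W s))) : (i < size s)%N.
  by rewrite -(size_map W) ltn_ord.
move=> sum0 i.
(* [k0] only serves as default for [nth]; the index [i] shows that [s] is nonempty, which matters
   since [n] may be 0. *)
have [k0 _] : exists k0 : 'I_n * 'I_n, true.
  have := leq_ltn_trans (leq0n i) (in_s i).
  by case: (s) => // k; exists k.
have nthW (j : 'I_(size (map W s))) : (in_tuple (map W s))`_j = W (nth k0 s j).
  by rewrite /= (nth_map k0) // in_s.
have keyP (j : 'I_(size (map W s))) : exists l, nth k0 s j = key l.
  have : nth k0 s j \in key @: I by rewrite -mem_enum mem_nth // in_s.
  by case/imsetP => l _ ->; exists l.
have [l El] := keyP i.
(* At the entry dual to the [i]-th key every other term of the vanishing combination is zero, which
   isolates [a i]. *)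
have := congr1 (fun M : 'M_n => M (key l).2 (key l).1) sum0.
rewrite summxE mxE (bigD1 i) //= big1 ?addr0 => [|j ne_ji].
  rewrite mxE nthW El => /eqP; rewrite mulf_eq0 => /orP[/eqP //|].
  by rewrite -[_ == 0]negbK dualW eqxx.
rewrite mxE nthW; have [m Em] := keyP j.
rewrite Em; apply/eqP; rewrite mulf_eq0; apply/orP; right.
by apply: contraNT ne_ji; rewrite dualW -Em -El nth_uniq ?enum_uniq ?in_s.
Qed.

(** Canonical representative of an unordered pair, loops included; as a key it still designates a
    matrix entry. *)
Definition ordered_pair (n : nat) (p : 'I_n * 'I_n) : 'I_n * 'I_n :=
  if (p.1 <= p.2)%N then p else (p.2, p.1).

Lemma ordered_pair_le (n : nat) (p : 'I_n * 'I_n) :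
  ((ordered_pair p).1 <= (ordered_pair p).2)%N.
Proof. by rewrite /ordered_pair; case: (leqP p.1) => //= /ltnW. Qed.

(** Inclusion-exclusion: [low] holds the weakly increasing arcs and [high] the reversals of the
    strictly decreasing ones. Their union is the set of edges, and their intersection corresponds to
    the digons. *)
Lemma card_arcs_edges (n : nat) (A : {set 'I_n * 'I_n}) :
  #|A| = (#|@ordered_pair n @: A| + #|digons (fun u v => (u, v) \in A)|)%N.
Proof.
pose low := [set p in A | (p.1 <= p.2)%N].
pose swap (p : 'I_n * 'I_n) := (p.2, p.1).
have swapK : involutive swap by case.
pose high := [set p | (swap p \in A) && (p.1 < p.2)%N].
have cardA : #|A| = (#|low| + #|high|)%N.
  rewrite -(card_imset high (inv_inj swapK)).
  rewrite -(cardsID low A); congr addn; apply: eq_card => p.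
    by rewrite !inE; case: (p \in A).
  rewrite -[in RHS](swapK p) mem_imset; last exact: inv_inj.
  by rewrite !inE swapK /= ltnNge; case: (p \in A); rewrite ?andbF ?andbT.
have -> : @ordered_pair n @: A = low :|: high.
  apply/setP => p; apply/imsetP/idP => [[[u v] uvA ->]|].
    by rewrite /ordered_pair !inE /=; case: (leqP u v) => /= h;
      rewrite ?uvA ?h ?orbT.
  case: p => u v; rewrite !inE /= => /orP[/andP[uvA le_uv]|/andP[vuA lt_uv]].
    by exists (u, v); rewrite // /ordered_pair /= le_uv.
  by exists (v, u); rewrite // /ordered_pair /= leqNgt lt_uv.
have -> : digons (fun u v => (u, v) \in A)
          = (fun p => [set p.1; p.2]) @: (low :&: high).
  apply/setP => e; apply/imset2P/imsetP => [[u v _]|[[u v]]].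
    rewrite !inE => /andP[_ /and3P[ne_uv uvA vuA]] ->.
    have [lt_uv|lt_vu|/val_inj eq_uv] := ltngtP u v;
      last by rewrite eq_uv eqxx in ne_uv.
      by exists (u, v); rewrite // !inE /= uvA vuA lt_uv ltnW.
    by exists (v, u); rewrite /= 1?setUC // !inE /= uvA vuA lt_vu ltnW.
  rewrite !inE /= => /andP[/andP[uvA _] /andP[vuA lt_uv]] ->.
  by exists u v; rewrite // !inE uvA vuA -val_eqE /= ltn_eqF.
rewrite card_in_imset => [|[u v] [u' v']].
  by rewrite cardA cardsUI.
rewrite !inE /= => /and3P[_ _ lt_uv] /and3P[_ _ lt_uv'] /setP eq_sets.
(* Of the four ways to match [u] and [v] with [u'] and [v'], only the order-preserving one is
   compatible with both strict inequalities. *)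
have := eq_sets u; have := eq_sets v; rewrite !inE !eqxx ?orbT.
move=> /esym/orP[]/eqP ev /esym/orP[]/eqP eu; subst => //.
- by rewrite ltnn in lt_uv.
- by rewrite ltnNge ltnW in lt_uv.
- by rewrite ltnn in lt_uv.
Qed.

(** A digon has distinct ends, so loops are invisible to it; this is what permits discarding
    self-loop tasks. *)
Lemma eq_digons (n : nat) (D D' : rel 'I_n) :
  (forall u v, u != v -> D u v = D' u v) -> digons D = digons D'.
Proof.
move=> eqD; apply/setP => e.
apply/imset2P/imset2P => -[u v _]; rewrite !inE => /andP[_ /and3P[ne_uv Duv Dvu]] ->;
  exists u v; rewrite // !inE ne_uv /=.
  by rewrite -!eqD ?Duv // eq_sym.
by rewrite !eqD ?Duv // eq_sym.
Qed.

Lemma delta_entry_neq0 (F : fieldType) (n : nat) (p q : 'I_n * 'I_n) :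
  ((delta_mx p.2 p.1 : 'M[F]_n) q.2 q.1 != 0) = (p == q).
Proof.
case: p q => [a b] [c d] /=.
rewrite mxE xpair_eqE andbC (eq_sym d) (eq_sym c).
by case: andb; rewrite ?oner_eq0 ?eqxx.
Qed.

(** Between ordered pairs, the transposed unit can meet the entry of [q] only if all four indices
    coincide. The two summands then add up to 2, which is nonzero in characteristic 0. *)
Lemma sym_delta_entry_neq0 (R : realType) (n : nat) (p q : 'I_n * 'I_n) :
  (p.1 <= p.2)%N -> (q.1 <= q.2)%N ->
  (sym (delta_mx p.2 p.1 : 'M[R]_n) q.2 q.1 != 0) = (p == q).
Proof.
case: p q => [a b] [c d] /= le_ab le_cd.
rewrite /sym !mxE mulf_eq0 invr_eq0 pnatr_eq0 /= -natrD pnatr_eq0 addn_eq0.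
rewrite !eqb0 -negb_or negbK xpair_eqE -!val_eqE /=; lia.
Qed.

Lemma sym_delta_ordered_pair (R : realType) (n : nat) (p : 'I_n * 'I_n) :
  sym (delta_mx p.2 p.1 : 'M[R]_n)
  = sym (delta_mx (ordered_pair p).2 (ordered_pair p).1).
Proof.
rewrite /ordered_pair; case: ifP => //= _.
by rewrite /sym !trmx_delta addrC.
Qed.

Lemma deficit_digons (R : realType) (n : nat) (I : finType)
    (L : I -> task R n) (sigma tau : I -> 'I_n) :
  (forall j, drive (L j) = std_basis R (sigma j)) ->
  (forall j, read (L j) = std_basis R (tau j)) ->
  deficit L = (#|digons (task_digraph sigma tau)|)%:Z.
Proof.
move=> hf hg; pose arc j := (sigma j, tau j).
have task_mxE j : task_mx (L j) = delta_mx (arc j).2 (arc j).1.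
  by rewrite /task_mx hf hg /std_basis trmx_delta mul_delta_mx.
have dim_arcs : \dim (task_span L) = #|arc @: I|.
  rewrite /task_span (eq_image (fun=> erefl) task_mxE).
  apply: (dim_span_dual_entries (W := fun p => delta_mx p.2 p.1)) => i j.
  exact: delta_entry_neq0.
have dim_edges : \dim (sym_task_span L) = #|@ordered_pair n @: (arc @: I)|.
  have sym_taskE j : sym (task_mx (L j)) =
      sym (delta_mx (ordered_pair (arc j)).2 (ordered_pair (arc j)).1).
    by rewrite task_mxE sym_delta_ordered_pair.
  rewrite /sym_task_span (eq_image (fun=> erefl) sym_taskE) -imset_comp.
  apply: (dim_span_dual_entries (key := @ordered_pair n \o arc)
            (W := fun p => sym (delta_mx p.2 p.1))) => i j.
  by apply: sym_delta_entry_neq0; apply: ordered_pair_le.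
rewrite /deficit dim_arcs dim_edges card_arcs_edges PoszD addrAC subrr add0r.
rewrite (@eq_digons _ _ (task_digraph sigma tau)) // => u v _.
apply/imsetP/existsP => [[j _ [-> ->]]|[j /andP[/eqP <- /eqP <-]]].
  by exists j; rewrite !eqxx.
by exists j.
Qed.

Theorem corollary8 (R : realType) (n J : nat) (L : 'I_J -> task R n)
    (sigma tau : 'I_J -> 'I_n)
    (hf : forall j : 'I_J, drive (L j) = std_basis R (sigma j))
    (hg : forall j : 'I_J, read (L j) = std_basis R (tau j)) :
  [/\ deficit L = (#|digons (task_digraph sigma tau)|)%:Z,
      forall S : {set 'I_J},
        (forall j : 'I_J, sigma j != tau j -> j \in S) ->
        deficit (sublist L S) = deficit L
    & deficit L = 0 <->
        ~ (exists u v : 'I_n, [/\ u != v, task_digraph sigma tau u v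
                               & task_digraph sigma tau v u])].
Proof.
split; first exact: deficit_digons.
  move=> S nonloopS; rewrite (deficit_digons hf hg).
  rewrite (@deficit_digons _ _ _ (sublist L S) (sigma \o val) (tau \o val)) //=;
    try by move=> j /=; rewrite /sublist ?hf ?hg.
  rewrite (@eq_digons _ _ (task_digraph sigma tau)) // => u v ne_uv.
  apply/existsP/existsP => [[j Ej]|[j /andP[/eqP Eu /eqP Ev]]].
    by exists (val j).
  (* A task realizing an arc between distinct vertices is no self-loop, hence survives in the
     sublist. *)
  have jS : j \in S by rewrite nonloopS // Eu Ev.
  by exists (exist _ j jS); rewrite /= Eu Ev !eqxx.
rewrite (deficit_digons hf hg); split=> [[/eqP]|no_digon].
  rewrite cards_eq0 => /eqP digons0 [u [v [ne_uv Duv Dvu]]].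
  have : [set u; v] \in digons (task_digraph sigma tau).
    by apply/imset2P; exists u v; rewrite // !inE ne_uv Duv Dvu.
  by rewrite digons0 inE.
apply/eqP; rewrite eqz_nat cards_eq0; apply/set0Pn => -[e /imset2P[u v _]].
by rewrite !inE => /andP[_ /and3P[ne_uv Duv Dvu]] _; apply: no_digon; exists u, v.
Qed.
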